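(* Let $m,r,t\geq 2$ be integers and let $C_{m,r}$ be a cycle poset. Then $\Delta_t(C_{m,r})$ is a simplicial tree if and only if one of the following holds: (i) $C_{m,r}$ is not a graded poset and $t>\min(m,r)$; (ii) $C_{m,r}$ is a graded poset and $t=m$.
   Context: The cycle poset $C_{m,r}$ is the poset having exactly two maximal saturated chains $x_{i_1}<\cdots<x_{i_m}$ and $x_{j_1}<\cdots<x_{j_r}$, with $m$ and $r$ elements respectively, where $x_{i_1}=x_{j_1}$, $x_{i_m}=x_{j_r}$ and the two chains have no other elements in common; its cover relations are exactly the consecutive relations in these two chains, so that its Hasse diagram is a cycle as an undirected graph (in the degenerate case $m=r=2$ the two chains coincide and $C_{2,2}$ is the two-element chain). $C_{m,r}$ is graded if and only if $m=r$. A path of length $t$ in a poset is a saturated chain of $t$ elements (each element covers the previous one). $\Delta_t(P)$ is the simplicial complex whose facets are exactly the vertex sets of the paths of length $t$ in $P$. Let $\mathcal{F}(\Delta)$ be the set of facets of a simplicial complex $\Delta$. A facet $F$ of $\Delta$ is a leaf if either $F$ is the only facet of $\Delta$ or there exists a facet $G\neq F$ of $\Delta$ such that $F\cap H\subseteq F\cap G$ for every $H\in\mathcal{F}(\Delta)$ with $H\neq F$. $\Delta$ is a simplicial tree if it is connected and every non-empty subcomplex generated by a subset of $\mathcal{F}(\Delta)$ contains a leaf; by convention the empty complex is a simplicial tree.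
   Formalization: In the graded case the formal theorem assumes t ≤ m; for m = r < t (e.g. m = r = 2, t = 3) there are no paths of length t, so Δ_t is empty and a simplicial tree by convention, yet neither (i) nor (ii) holds. *)

(* Defs.v *)
From HB Require Import structures.
From mathcomp Require Import all_boot all_order.
Set Implicit Arguments.
Unset Strict Implicit.
Unset Printing Implicit Defensive.
Import Order.TTheory.
Local Open Scope order_scope.

Section SimplicialComplexes.
Variable V : finType.

(* The vertices are the x with [set x] a face, so an element of V need not be
   a vertex. The empty complex is the one with no face at all. *)
Record simplicial_complex := SimplicialComplex {
  faces :> {set {set V}};
  faces_down : forall A B : {set V}, A \subset B -> B \in faces -> A \in faces
}.

Implicit Types (D : simplicial_complex) (F G H : {set V}) (S : {set {set V}}).

Definition generated_faces S : {set {set V}} :=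
  [set A : {set V} | [exists F in S, A \subset F]].

Lemma generated_faces_down S (A B : {set V}) :
  A \subset B -> B \in generated_faces S -> A \in generated_faces S.
Proof.
move=> sAB; rewrite !inE => /exists_inP [F FS sBF].
by apply/exists_inP; exists F => //; apply: subset_trans sBF.
Qed.

Definition generated_complex S : simplicial_complex :=
  SimplicialComplex (@generated_faces_down S).

Definition facets D : {set {set V}} :=
  [set F | maxset (fun A => A \in faces D) F].

Definition leaf D F : Prop :=
  F \in facets D /\
  (facets D = [set F] \/
   exists G, [/\ G \in facets D, G != F &
     forall H, H \in facets D -> H != F -> F :&: H \subset F :&: G]).

Definition connected_complex D : Prop :=
  forall x y, [set x] \in faces D -> [set y] \in faces D ->
    connect (fun u v => [set u; v] \in faces D) x y.

(* Both conditions hold vacuously when D has no face, so the empty complex is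
   a simplicial tree. *)
Definition simplicial_tree D : Prop :=
  connected_complex D /\
  forall S, S \subset facets D -> S != set0 ->
    exists F, leaf (generated_complex S) F.

End SimplicialComplexes.

Section Posets.
Variables (d : Order.disp_t) (P : finPOrderType d).
Implicit Types (x y z : P) (s : seq P).

Definition covered_by : rel P :=
  fun x y => (x < y) && [forall z, ~~ ((x < z) && (z < y))].

(* Chains are listed in increasing order. *)
Definition saturated_chain s : bool := sorted covered_by s.

Definition maximal_saturated_chain s : Prop :=
  saturated_chain s /\
  forall s', saturated_chain s' -> {subset s <= s'} -> s' = s.

Definition graded : Prop :=
  forall s s', maximal_saturated_chain s -> maximal_saturated_chain s' ->
    size s = size s'.

(* The chains are c1 = a < s1 < b and c2 = a < s2 < b. They coincide only when
   s1 and s2 are both empty, that is, for m = r = 2. *)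
Definition cycle_poset (m r : nat) : Prop :=
  exists (a b : P) (s1 s2 : seq P),
    let c1 := a :: rcons s1 b in let c2 := a :: rcons s2 b in
    [/\ size c1 = m /\ size c2 = r,
        maximal_saturated_chain c1 /\ maximal_saturated_chain c2,
        forall s, maximal_saturated_chain s -> s = c1 \/ s = c2,
        [disjoint s1 & s2] &
        forall x y, covered_by x y = infix [:: x; y] c1 || infix [:: x; y] c2].

Definition path_sets (t : nat) : {set {set P}} :=
  [set [set x in tval s] | s : t.-tuple P & saturated_chain s].

(* All generators have t elements, so they are exactly the facets. *)
Definition path_complex (t : nat) : simplicial_complex P :=
  generated_complex (path_sets t).

End Posets.

Arguments graded {d} P.
Arguments cycle_poset {d} P m r.
Arguments path_sets {d} P t.
Arguments path_complex {d} P t.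

(* Main.v *)
(** The paths of length [t] in a cycle poset are the windows of [t] consecutive
    elements of its two maximal chains, which share only their endpoints. If
    one chain is too short to have windows, ordering the windows of the other
    chain by starting point shows that the first one is always a leaf, with the
    second one as its joint. If both chains are single windows, there are at
    most two facets, both through the minimum. If both chains have windows and one of them has
    more than one, the windows go around a cycle: whatever the window [F], the
    other facets meet [F] in too many points for a single other facet to
    contain all these intersections. *)
Require Import Defs.
From mathcomp Require Import all_boot all_order.
From mathcomp Require Import zify.
Set Implicit Arguments.
Unset Strict Implicit.
Unset Printing Implicit Defensive.
Import Order.TTheory.

(** * Windows of a sequence without repetition, and the complexes they generate *)

Section Windows.
Variable V : finType.
Implicit Types (x y : V) (c s : seq V) (t i : nat) (S : {set {set V}}).

Definition window c t i : {set V} := [set x in take t (drop i c)].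

Definition windows c t : {set {set V}} :=
  [set window c t i | i : 'I_(size c).+1 & i + t <= size c].

Lemma windowsP c t (A : {set V}) :
  reflect (exists2 i, i + t <= size c & A = window c t i) (A \in windows c t).
Proof.
apply: (iffP imsetP) => [[i]|[i it ->]]; first by rewrite inE => it ->; exists i.
have lt_i : i < (size c).+1 by lia.
by exists (Ordinal lt_i); rewrite ?inE.
Qed.

Lemma window_in c t i : i + t <= size c -> window c t i \in windows c t.
Proof. by move=> it; apply/windowsP; exists i. Qed.

Lemma windows_gt c t : size c < t -> windows c t = set0.
Proof.
move=> lt_c; apply/setP=> A; rewrite inE; apply/windowsP => -[i it _]; lia.
Qed.

Lemma windows_size c : windows c (size c) = [set [set x in c]].
Proof.
apply/setP=> A; rewrite !inE; apply/windowsP/eqP => [[i it ->]|->].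
  have -> : i = 0 by lia.
  by rewrite /window drop0 take_size.
by exists 0; rewrite // /window drop0 take_size.
Qed.

(** Without repetitions [index x c] is the only position of [x], so questions about windows become
    arithmetic on indices. *)
Lemma mem_window c t i x : uniq c ->
  (x \in window c t i) = (x \in c) && (i <= index x c < i + t).
Proof.
move=> uc; rewrite inE; have [xc|xNc] /= := boolP (x \in c); last first.
  by apply: contraNF xNc => /mem_take /mem_drop.
have := uc; rewrite -[c in uniq c](cat_take_drop i) cat_uniq => /and3P[_ disj _].
move: (xc); rewrite -{1}(cat_take_drop i c) mem_cat.
have [xti _|xti /= xdi] := boolP (x \in take i c).
  have -> : (i <= index x c) = false.
    by apply/negbTE; rewrite -ltnNge -in_take.
  apply/negbTE; apply: contra disj => /mem_take xdi.
  by apply/hasP; exists x.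
rewrite in_take // -{2 3}(cat_take_drop i c) index_cat (negbTE xti).
have lt_i : i < size c.
  by case: (ltnP i (size c)) => // le_c; rewrite drop_oversize in xdi.
by rewrite size_takel ?(ltnW lt_i) // leq_addr ltn_add2l.
Qed.

Lemma card_window c t i : uniq c -> i + t <= size c -> #|window c t i| = t.
Proof.
move=> uc it; rewrite cardsE (card_uniqP _) ?take_uniq ?drop_uniq //.
by rewrite size_takel // size_drop -{1}(addKn i t) leq_sub2r.
Qed.

Lemma nth_window x0 c t i k : uniq c -> k < size c ->
  (nth x0 c k \in window c t i) = (i <= k < i + t).
Proof. by move=> uc kc; rewrite mem_window // mem_nth // index_uniq. Qed.

Lemma card_windows c t (A : {set V}) : uniq c -> A \in windows c t -> #|A| = t.
Proof. by move=> uc /windowsP[i it ->]; apply: card_window. Qed.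

(** Distinct sets of equal cardinality are incomparable, so no generator is absorbed by another. *)
Lemma generated_facets S t :
  (forall F, F \in S -> #|F| = t) -> facets (generated_complex S) = S.
Proof.
move=> cardS; apply/setP=> F; rewrite inE.
apply/maxsetP/idP => [[/=]|FS].
  rewrite inE => /exists_inP[G GS sFG] maxF.
  rewrite -(maxF G) //.
  by rewrite inE; apply/exists_inP; exists G.
split=> [|G]; first by rewrite inE; apply/exists_inP; exists F.
rewrite inE => /exists_inP[H HS sGH] sFG; apply/eqP.
rewrite eq_sym eqEcard sFG (cardS F) // -(cardS H) //.
exact: subset_leq_card.
Qed.

Lemma leaf_generated S t F : (forall F', F' \in S -> #|F'| = t) ->
  leaf (generated_complex S) F <->
  F \in S /\ (S = [set F] \/ exists G, [/\ G \in S, G != F &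
     forall H, H \in S -> H != F -> F :&: H \subset F :&: G]).
Proof. by move=> cardS; rewrite /leaf (generated_facets cardS). Qed.

Lemma windows_leaf c t S : uniq c -> S \subset windows c t -> S != set0 ->
  exists F, leaf (generated_complex S) F.
Proof.
move=> uc /subsetP sS /set0Pn [A AS].
have cardS F : F \in S -> #|F| = t by move/sS; apply: card_windows.
have exF : exists i, window c t i \in S.
  by move: (AS) => /sS /windowsP[i _ defA]; exists i; rewrite -defA.
have [i FS minF] := ex_minnP exF; exists (window c t i).
apply/(leaf_generated _ cardS); split=> //.
have [->|SnF] := eqVneq S [set window c t i]; [by left | right].
have exG : exists j, (window c t j \in S) && (window c t j != window c t i).
  have /subsetPn[B BS] : ~~ (S \subset [set window c t i]).
    by apply: contra SnF => sSF; rewrite eqEsubset sSF sub1set.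
  rewrite inE => neB.
  by move: (BS) => /sS /windowsP[j _ defB]; exists j; rewrite -defB BS.
have [j /andP[GS neG] minG] := ex_minnP exG; exists (window c t j).
(* For starting points [i <= j <= k], a point common to the windows at [i] and [k] has index at
   least [k >= j] and below [i + t <= j + t], hence lies in the window at [j]. *)
split=> // H HS neH; rewrite subsetI subsetIl; apply/subsetP=> x.
move: (HS) => /sS /windowsP[k _ defH].
have jk : j <= k by apply: minG; rewrite -defH HS.
have ij : i <= j by apply: minF.
rewrite defH inE !mem_window // => /andP[/andP[-> ?] /andP[_ ?]]; lia.
Qed.

Lemma windows_connected c t : 2 <= t -> uniq c ->
  connected_complex (generated_complex (windows c t)).
Proof.
move=> t2 uc x y; set e := (fun u v => _).
have vertexP z : [set z] \in generated_faces (windows c t) ->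
    z \in c /\ t <= size c.
  rewrite inE => /exists_inP[A /windowsP[i it ->]].
  by rewrite sub1set mem_window // => /andP[-> _]; split=> //; lia.
move=> /vertexP[xc tc] /vertexP[yc _].
have e_sym : connect_sym e by apply: sym_connect_sym => u v; rewrite /e setUC.
have conn k : k < size c -> connect e (nth x c 0) (nth x c k).
  elim: k => // k IH kc; apply: (connect_trans (IH (ltnW kc))).
  (* A window holding positions [k] and [k.+1]: the one starting at [k] if it fits, otherwise the
     last one. *)
  have [i [it ik ki]] : exists i, [/\ i + t <= size c, i <= k & k.+1 < i + t].
    case: (leqP (k + t) (size c)) => ?; first by exists k; split; lia.
    by exists (size c - t); split; lia.
  apply: connect1; rewrite /e /= inE; apply/exists_inP.
  exists (window c t i); first exact: window_in.
  by rewrite subUset !sub1set !nth_window //; lia.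
rewrite -(nth_index x xc) -(nth_index x yc).
apply: (connect_trans (y := nth x c 0)); last by apply: conn; rewrite index_mem.
by rewrite e_sym; apply: conn; rewrite index_mem.
Qed.

Lemma windows_tree c t : 2 <= t -> uniq c ->
  simplicial_tree (generated_complex (windows c t)).
Proof.
move=> t2 uc; split; first exact: windows_connected.
move=> S sS S0; apply: (windows_leaf (c := c) (t := t)) => //.
by move: sS; rewrite (generated_facets (fun F => card_windows uc (A := F))).
Qed.

(** The common vertex [x] is adjacent to all others. A facet has at most one other facet to meet,
    which is then its joint. [A] and [B] may coincide, as happens for [m = r = 2]. *)
Lemma two_facets_tree (A B : {set V}) x : #|A| = #|B| -> x \in A -> x \in B ->
  simplicial_tree (generated_complex [set A; B]).
Proof.
move=> cardAB xA xB.
have card2 S : S \subset [set A; B] -> forall F, F \in S -> #|F| = #|A|.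
  by move=> /subsetP sS F /sS /set2P[] ->.
split.
  move=> y z; set e := (fun u v => _).
  have e_sym : connect_sym e by apply: sym_connect_sym => u v; rewrite /e setUC.
  have to_x w : [set w] \in generated_faces [set A; B] -> connect e w x.
    rewrite inE => /exists_inP[F F2]; rewrite sub1set => wF.
    apply: connect1; rewrite /e /= inE; apply/exists_inP; exists F => //.
    by rewrite subUset !sub1set wF; case/set2P: F2 => ->.
  move=> /to_x yx /to_x zx.
  by apply: connect_trans yx _; rewrite e_sym.
move=> S; rewrite (generated_facets (card2 _ (subxx _))) => sS /set0Pn[F FS].
exists F; apply/(leaf_generated _ (card2 S sS)); split=> //.
have [->|SnF] := eqVneq S [set F]; [by left | right].
have /subsetPn[G GS] : ~~ (S \subset [set F]).
  by apply: contra SnF => sSF; rewrite eqEsubset sSF sub1set.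
rewrite inE => neG; exists G; split=> // H HS neH.
suff -> : H = G by [].
move/subsetP: sS => sS.
by case/set2P: (sS _ FS) neG neH => ->;
   case/set2P: (sS _ GS) => ->; case/set2P: (sS _ HS) => ->; rewrite ?eqxx.
Qed.

End Windows.

(** * Windows of two chains that share only their endpoints *)

Section TwoChains.
Variables (V : finType) (a b : V).
Implicit Types s : seq V.
Local Notation chain s := (a :: rcons s b).

Lemma chain_meet s1 s2 x : [disjoint s1 & s2] ->
  x \in chain s1 -> x \in chain s2 -> x = a \/ x = b.
Proof.
move=> dis; rewrite !inE !mem_rcons !inE.
case/or3P=> [/eqP->|/eqP->|x1]; [by left|by right|].
case/or3P=> [/eqP->|/eqP->|x2]; [by left|by right|].
by rewrite (disjointFr dis x1) in x2.
Qed.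

Lemma index_last s : uniq (chain s) -> index b (chain s) = (size s).+1.
Proof.
move=> us; have := index_uniq a _ us (i := (size s).+1).
by rewrite /= size_rcons nth_rcons ltnn eqxx => ->.
Qed.

Lemma index_meet s1 s2 x : uniq (chain s1) -> [disjoint s1 & s2] ->
  x \in chain s1 -> x \in chain s2 ->
  index x (chain s1) = 0 \/ index x (chain s1) = (size s1).+1.
Proof.
move=> us dis x1 x2; case: (chain_meet dis x1 x2) => ->.
  by left; rewrite /= eqxx.
by right; apply: index_last.
Qed.

Lemma first_in_window s t i : uniq (chain s) ->
  (a \in window (chain s) t i) = (i == 0) && (0 < t).
Proof. by move=> us; rewrite mem_window // inE eqxx /= eqxx; lia. Qed.

Lemma last_in_window s t i : uniq (chain s) ->
  (b \in window (chain s) t i) = (i <= (size s).+1 < i + t).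
Proof.
by move=> us; rewrite mem_window // index_last // inE mem_rcons mem_head orbT.
Qed.

(* A proper window contains an interior point of its chain. *)
Lemma window_neq s1 s2 t i j : uniq (chain s1) -> uniq (chain s2) ->
  [disjoint s1 & s2] -> 2 <= t -> t < size (chain s1) ->
  i + t <= size (chain s1) -> window (chain s1) t i != window (chain s2) t j.
Proof.
move=> u1 u2 dis t2; rewrite /= size_rcons => tc it.
(* Position [i], or 1 when the window starts at [a]; since [t] is at least 2 and less than the
   length of the chain, it stays in the window and before the last position. *)
pose k := maxn i 1.
have kc : k < size (chain s1) by rewrite /= size_rcons /k; lia.
apply/eqP => /setP /(_ (nth a (chain s1) k)).
rewrite nth_window // (_ : i <= k < i + t); last by rewrite /k; lia.
rewrite mem_window // => /esym /andP[x2 _].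
have := index_meet u1 dis (mem_nth a kc) x2.
by rewrite index_uniq // /k; lia.
Qed.

(** The other facets cover the window, so a joint would contain it and, having the same cardinality,
    be equal to it. *)
Lemma proper_window_not_leaf s1 s2 t i S :
  uniq (chain s1) -> uniq (chain s2) -> [disjoint s1 & s2] ->
  2 <= t -> t < size (chain s1) -> t <= size (chain s2) ->
  S = windows (chain s1) t :|: windows (chain s2) t ->
  i + t <= size (chain s1) ->
  ~ leaf (generated_complex S) (window (chain s1) t i).
Proof.
move=> u1 u2 dis t2 tc1 tc2 defS it.
have cardS F : F \in S -> #|F| = t.
  by rewrite defS => /setUP[]; apply: card_windows.
set F := window _ _ _.
have FS : F \in S by rewrite defS inE window_in.
have in1 j : j + t <= size (chain s1) -> window (chain s1) t j \in S.
  by move=> jt; rewrite defS inE window_in.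
have in2 j : j + t <= size (chain s2) -> window (chain s2) t j \in S.
  by move=> jt; rewrite defS inE window_in ?orbT.
have neF j : window (chain s2) t j != F by rewrite eq_sym window_neq.
(* The smaller of the two starting points lies in one window only. *)
have neF1 j : j != i -> j + t <= size (chain s1) ->
    window (chain s1) t j != F.
  move=> ji jt; apply/eqP=> /setP E.
  have := E (nth a (chain s1) i); have := E (nth a (chain s1) j).
  by rewrite !nth_window; try lia.
(* Shifting the window by one to the left or to the right keeps [x], unless [x] is an endpoint of
   the chain; then the first or last window of the other chain contains it. *)
have cover x : x \in F -> exists H, [/\ H \in S, H != F & x \in H].
  rewrite mem_window // => /andP[xc1 xi].
  have [/andP[k0 ki]|N1] := boolP ((0 < i) && (index x (chain s1) < (i + t).-1)).
    exists (window (chain s1) t i.-1).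
    by rewrite mem_window // xc1; split; [apply: in1|apply: neF1|]; lia.
  have [/andP[k0 ki]|N2] :=
      boolP ((i < index x (chain s1)) && (i + t < size (chain s1))).
    exists (window (chain s1) t i.+1).
    by rewrite mem_window // xc1; split; [apply: in1|apply: neF1|]; lia.
  have sz1 : size (chain s1) = (size s1).+2 by rewrite /= size_rcons.
  have sz2 : size (chain s2) = (size s2).+2 by rewrite /= size_rcons.
  have [x0|xb] : index x (chain s1) = 0 \/ index x (chain s1) = (size s1).+1.
    by lia.
  - have -> : x = a by rewrite -(nth_index a xc1) x0.
    exists (window (chain s2) t 0).
    by rewrite first_in_window //; split; [apply: in2|exact: neF|]; lia.
  - have -> : x = b by rewrite -(nth_index a xc1) xb /= nth_rcons ltnn eqxx.
    exists (window (chain s2) t ((size s2).+2 - t)).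
    by rewrite last_in_window //; split; [apply: in2|exact: neF|]; lia.
move/(leaf_generated _ cardS) => [_ [SF|[G [GS neG subG]]]].
  by have := in2 0 tc2; rewrite SF inE (negbTE (neF 0)).
case/negP: neG; rewrite eq_sym eqEcard (cardS F) // (cardS G) // leqnn andbT.
apply/subsetP=> x xF; have [H [HS neH xH]] := cover x xF.
by have /subsetP/(_ x) := subG H HS neH; rewrite !in_setI xF xH => /(_ isT).
Qed.

(** The window is the whole first chain, so it meets the first window of the second chain in [a] and
    the last one in [b]. A joint would contain both, but a window of the longer second chain cannot,
    and the first chain has no other window. *)
Lemma full_window_not_leaf s1 s2 t i S :
  uniq (chain s1) -> uniq (chain s2) -> [disjoint s1 & s2] ->
  2 <= t -> t = size (chain s1) -> t < size (chain s2) ->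
  S = windows (chain s1) t :|: windows (chain s2) t ->
  i + t <= size (chain s1) ->
  ~ leaf (generated_complex S) (window (chain s1) t i).
Proof.
move=> u1 u2 dis t2 tc1 tc2 defS it.
have i0 : i = 0 by lia.
rewrite {}i0 in it *.
have dis' : [disjoint s2 & s1] by rewrite disjoint_sym.
have cardS F : F \in S -> #|F| = t.
  by rewrite defS => /setUP[]; apply: card_windows.
set F := window _ _ _.
have in2 j : j + t <= size (chain s2) -> window (chain s2) t j \in S.
  by move=> jt; rewrite defS inE window_in ?orbT.
have neF j : j + t <= size (chain s2) -> window (chain s2) t j != F.
  by move=> jt; rewrite window_neq.
have aF : a \in F by rewrite first_in_window //; lia.
have bF : b \in F.
  by rewrite last_in_window // add0n tc1 /= size_rcons.
move: tc2; rewrite /= size_rcons => tc2.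
move/(leaf_generated _ cardS) => [_ [SF|[G [GS neG subG]]]].
  have t0 : 0 + t <= size (chain s2) by rewrite /= size_rcons; lia.
  by have := in2 0 t0; rewrite SF inE (negbTE (neF 0 t0)).
have aG : a \in G.
  have t0 : 0 + t <= size (chain s2) by rewrite /= size_rcons; lia.
  have /subsetP/(_ a) := subG _ (in2 _ t0) (neF _ t0).
  by rewrite !in_setI aF first_in_window //= => /(_ (ltnW t2)).
have bG : b \in G.
  have tl : (size s2).+2 - t + t <= size (chain s2) by rewrite /= size_rcons; lia.
  have /subsetP/(_ b) := subG _ (in2 _ tl) (neF _ tl).
  by rewrite !(in_setI, bF) last_in_window //= => -> //; lia.
move: GS; rewrite defS => /setUP[] /windowsP[j jt defG].
  case/negP: neG; rewrite defG.
  by have -> : j = 0 by lia.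
by move: aG bG; rewrite defG first_in_window // last_in_window //; lia.
Qed.

Lemma two_chains_not_tree s1 s2 t :
  uniq (chain s1) -> uniq (chain s2) -> [disjoint s1 & s2] -> 2 <= t ->
  t <= size (chain s1) -> t <= size (chain s2) ->
  (t < size (chain s1)) || (t < size (chain s2)) ->
  ~ simplicial_tree
      (generated_complex (windows (chain s1) t :|: windows (chain s2) t)).
Proof.
move=> u1 u2 dis t2 tc1 tc2 tc [_].
have dis' : [disjoint s2 & s1] by rewrite disjoint_sym.
(* The subcomplex without a leaf is the one generated by all the facets. *)
set S := _ :|: _ => /(_ S).
have cardS F : F \in S -> #|F| = t by case/setUP; apply: card_windows.
have defS' : S = windows (chain s2) t :|: windows (chain s1) t by apply: setUC.
rewrite (generated_facets cardS) subxx => /(_ isT) [].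
  by apply/set0Pn; exists (window (chain s1) t 0); rewrite inE window_in.
move=> F leafF; have [/setUP[] /windowsP[i it defF] _] :=
  proj1 (leaf_generated F cardS) leafF; move: leafF; rewrite defF.
- case: (ltnP t (size (chain s1))) => ts.
    exact: (@proper_window_not_leaf s1 s2).
  by apply: (@full_window_not_leaf s1 s2) => //; lia.
- case: (ltnP t (size (chain s2))) => ts.
    exact: (@proper_window_not_leaf s2 s1).
  by apply: (@full_window_not_leaf s2 s1) => //; lia.
Qed.

End TwoChains.

(** * Paths of a cycle poset as windows of its two maximal chains *)

Section CyclePosets.
Variables (d : Order.disp_t) (P : finPOrderType d).
Implicit Types (a b x y : P) (s c : seq P).

Lemma saturated_uniq s : saturated_chain s -> uniq s.
Proof.
move=> cs; apply: (@lt_sorted_uniq _ P).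
by apply: sub_sorted cs => x y /andP[].
Qed.

Lemma index_cat_cons x (p q : seq P) :
  uniq (p ++ x :: q) -> index x (p ++ x :: q) = size p.
Proof.
rewrite index_cat cat_uniq /= eqxx addn0 negb_or => /and3P[_ /andP[xp _] _].
by rewrite (negbTE xp).
Qed.

Lemma infix_next c x y s : uniq c -> infix [:: x, y & s] c ->
  index y c = (index x c).+1 /\ index y c < size c.
Proof.
move=> uc /infixP[p [q defc]]; move: uc; rewrite defc /= => uc.
rewrite (index_cat_cons uc) index_mem mem_cat !inE eqxx !orbT; split=> //.
by move: uc; rewrite -cat_rcons => /index_cat_cons ->; rewrite size_rcons.
Qed.

(** As [y] occurs only once in [c], both factors locate it at the same position, and what precedes
    it must agree. *)
Lemma infix_cons_uniq c x y s : uniq c -> infix [:: x; y] c -> infix (y :: s) c ->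
  infix (x :: y :: s) c.
Proof.
move=> uc /infixP[p [q defc]] /infixP[p' [q' defc']].
have defc1 : c = rcons p x ++ y :: q by rewrite defc cat_rcons.
have szp : size (rcons p x) = size p'.
  have := uc; rewrite {1}defc1 => /index_cat_cons <-; rewrite -defc1.
  by have := uc; rewrite {1}defc' => /index_cat_cons <-; rewrite -cat_cons -defc'.
have /eqP := defc1; rewrite defc' eqseq_cat // => /andP[/eqP defp' _].
by apply/infixP; exists p, q'; rewrite defp' cat_rcons.
Qed.

Lemma saturated_infix a b s1 s2 s :
  let c1 := a :: rcons s1 b in let c2 := a :: rcons s2 b in
  uniq c1 -> uniq c2 -> [disjoint s1 & s2] ->
  (forall x y, covered_by x y = infix [:: x; y] c1 || infix [:: x; y] c2) ->
  2 <= size s -> saturated_chain s -> infix s c1 || infix s c2.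
Proof.
move=> c1 c2 u1 u2 dis cov.
(* A path could only change chain at a common interior point. *)
have noswitch t1 t2 x y z s' : uniq (a :: rcons t1 b) -> uniq (a :: rcons t2 b) ->
    [disjoint t1 & t2] -> infix [:: x; y] (a :: rcons t1 b) ->
    ~~ infix [:: y, z & s'] (a :: rcons t2 b).
  move=> v1 v2 disT inf1; apply/negP=> inf2.
  have [y1 y1s] := infix_next v1 inf1; have [z2 z2s] := infix_next v2 inf2.
  have y2s : index y (a :: rcons t2 b) < size (a :: rcons t2 b) by lia.
  move: y1s y2s; rewrite !index_mem => /(chain_meet disT)/[apply].
  (* The predecessor [x] in one chain excludes [y = a], and the successor [z] in the other excludes
     [y = b]. *)
  case=> defy; first by move: y1; rewrite defy /= eqxx.
  by move: z2s; rewrite z2 defy index_last //= size_rcons; lia.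
elim: s => // x [|y s] IH // _ /= /andP[cxy ps].
case: s ps IH => [|z s] ps IH; first by rewrite -cov.
have := IH isT ps; move: cxy; rewrite cov.
case/orP=> i1 /orP[] i2.
- by apply/orP; left; apply: infix_cons_uniq i2.
- by case/negP: (noswitch s1 s2 x y z s u1 u2 dis i1).
- have dis' : [disjoint s2 & s1] by rewrite disjoint_sym.
  by case/negP: (noswitch s2 s1 x y z s u2 u1 dis' i1).
- by apply/orP; right; apply: infix_cons_uniq i2.
Qed.

Lemma windows_infix c t (s : t.-tuple P) :
  infix s c -> [set x in tval s] \in windows c t.
Proof.
case/infixP=> p [q ->]; apply/windowsP; exists (size p).
  by rewrite !size_cat size_tuple leq_add2l leq_addr.
by rewrite /window drop_size_cat // take_size_cat // size_tuple.
Qed.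

Lemma windows_path_sets c t : saturated_chain c -> windows c t \subset path_sets P t.
Proof.
move=> cc; apply/subsetP=> A /windowsP[i it ->].
have sz : size (take t (drop i c)) == t.
  by rewrite size_takel // size_drop -{1}(addKn i t) leq_sub2r.
apply/imsetP; exists (Tuple sz); rewrite // inE.
by rewrite /saturated_chain /= take_sorted // drop_sorted.
Qed.

Lemma path_sets_windows a b s1 s2 t :
  let c1 := a :: rcons s1 b in let c2 := a :: rcons s2 b in
  saturated_chain c1 -> saturated_chain c2 -> [disjoint s1 & s2] ->
  (forall x y, covered_by x y = infix [:: x; y] c1 || infix [:: x; y] c2) ->
  2 <= t -> path_sets P t = windows c1 t :|: windows c2 t.
Proof.
move=> c1 c2 cc1 cc2 dis cov t2; apply/eqP.
rewrite eqEsubset subUset !windows_path_sets // !andbT.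
apply/subsetP=> A /imsetP[s]; rewrite inE => cs ->; rewrite inE.
have t2s : 2 <= size s by rewrite size_tuple.
have := saturated_infix (saturated_uniq cc1) (saturated_uniq cc2) dis cov t2s cs.
by case/orP=> /windows_infix ->; rewrite ?orbT.
Qed.

End CyclePosets.

(** * Path complexes of cycle posets that are simplicial trees *)

Theorem theorem4p12 (d : Order.disp_t) (P : finPOrderType d) (m r t : nat)
    (hm : 2 <= m) (hr : 2 <= r) (ht : 2 <= t)
    (hC : cycle_poset P m r)
    (* in the graded case P has paths of length t *)
    (hgt : graded P -> t <= m) :
  simplicial_tree (path_complex P t) <->
    (~ graded P /\ minn m r < t) \/ (graded P /\ t = m).
Proof.
have [a [b [s1 [s2 [[sz1 sz2] [max1 max2] maxE dis cov]]]]] := hC.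
have [[cc1 _] [cc2 _]] := (max1, max2).
have [u1 u2] := (saturated_uniq cc1, saturated_uniq cc2).
have gradedE : graded P <-> m = r.
  split=> [gr | emr s s' /maxE[] -> /maxE[] ->]; rewrite ?sz1 ?sz2 //.
  by rewrite -sz1 -sz2; apply: gr.
rewrite /path_complex (path_sets_windows cc1 cc2 dis cov ht).
have [tmin|tmin] := leqP t (minn m r).
  (* Both chains have windows here: either each is a single window, or one of them has several. *)
  have [[tm mr]|ne] : (t = m /\ m = r) \/ (t < m) || (t < r) by lia.
    split=> [_|_]; first by right; rewrite gradedE.
    have -> : windows (a :: rcons s1 b) t = [set [set x in a :: rcons s1 b]].
      by rewrite tm -sz1 windows_size.
    have -> : windows (a :: rcons s2 b) t = [set [set x in a :: rcons s2 b]].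
      by rewrite tm mr -sz2 windows_size.
    apply: (@two_facets_tree _ _ _ a); rewrite ?inE ?eqxx //.
    by rewrite !cardsE !(card_uniqP _) // sz1 sz2.
  (* Both conditions fail: the first needs [minn m r < t], the second gives [t = m = r]. *)
  split=> [tree|]; last by rewrite gradedE; lia.
  by case: (two_chains_not_tree u1 u2 dis ht _ _ _ tree); rewrite ?sz1 ?sz2; lia.
(* Gradedness would give [m = r < t], against [hgt]. *)
have ngr : ~ graded P by move=> gr; have := hgt gr; move/gradedE: gr; lia.
split=> [_|_]; first by left.
(* A chain shorter than [t] has no windows, so only those of the other chain remain; if there are
   none either, the complex is empty. *)
have [tm|tr] : m < t \/ r < t by lia.
  by rewrite (@windows_gt _ (a :: rcons s1 b)) ?sz1 // set0U; apply: windows_tree.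
by rewrite (@windows_gt _ (a :: rcons s2 b)) ?sz2 // setU0; apply: windows_tree.
Qed.
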